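(* Let $\rho\in(0,1]$ and $\theta>0$, and let $\nu_{\rho,\theta}$ be the $\Gamma$-grey measure on $\mathcal{S}'$, i.e. the unique probability measure on $(\mathcal{S}',\sigma^* )$ with $$\int_{\mathcal{S}'}e^{i\langle x,\xi\rangle}\,d\nu_{\rho,\theta}(x)=\frac{\Gamma(\rho,\theta+\tfrac12\langle\xi,\xi\rangle)}{\Gamma(\rho,\theta)},\qquad \xi\in\mathcal{S}.$$ Let $\xi\in\mathcal{S}$. Then $\int_{\mathcal{S}'}\langle x,\xi\rangle^{2n+1}\,d\nu_{\rho,\theta}(x)=0$ for every integer $n\ge0$, and for every integer $n\ge1$ $$\int_{\mathcal{S}'}\langle x,\xi\rangle^{2n}\,d\nu_{\rho,\theta}(x)=\frac{(-1)^{n+1}(2n)!\,\Gamma(\rho)\,\theta^{\rho-n}\,\langle\xi,\xi\rangle^{n}}{n!\,2^{n}\,\Gamma(\rho,\theta)}\,E^{\rho}_{1,\rho+1-n}(-\theta).$$ Moreover, for all $\xi_1,\xi_2\in\mathcal{S}$, $$\int_{\mathcal{S}'}\langle\omega,\xi_1\rangle\langle\omega,\xi_2\rangle\,d\nu_{\rho,\theta}(\omega)=\frac{\theta^{\rho-1}e^{-\theta}}{\Gamma(\rho,\theta)}\langle\xi_1,\xi_2\rangle,$$ and in particular $\|\langle\cdot,\xi\rangle\|^2_{L^2(\nu_{\rho,\theta})}=\theta^{\rho-1}e^{-\theta}\|\xi\|^2/\Gamma(\rho,\theta)$ for $\xi\in\mathcal{S}$.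
   Context: $\mathcal{S}=\mathcal{S}(\mathbb{R})$ is the space of real-valued Schwartz functions, $\mathcal{S}'$ its topological dual, and $\sigma^*$ the $\sigma$-algebra on $\mathcal{S}'$ generated by the cylinder sets. $\langle x,\xi\rangle$ for $x\in\mathcal{S}'$, $\xi\in\mathcal{S}$ is the dual pairing; for $\xi,\eta\in\mathcal{S}$, $\langle\xi,\eta\rangle$ is the $L^2(\mathbb{R},dx)$ inner product and $\|\cdot\|$ its norm. The measure $\nu_{\rho,\theta}$ exists by the Bochner-Minlos theorem. $\Gamma(\rho,x):=\int_x^{+\infty}e^{-w}w^{\rho-1}\,dw$ is the upper incomplete gamma function. The Prabhakar function is $E^{\gamma}_{\alpha,\beta}(x):=\sum_{j=0}^{\infty}\frac{(\gamma)_j x^j}{j!\,\Gamma(\alpha j+\beta)}$, where $(\gamma)_j:=\Gamma(\gamma+j)/\Gamma(\gamma)$ and $1/\Gamma$ is taken to be $0$ at nonpositive integers. *)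

(* Defs.v *)
From HB Require Import structures.
From mathcomp Require Import all_boot all_order all_algebra complex.
From mathcomp Require Import all_classical all_reals all_analysis.

Set Implicit Arguments.
Unset Strict Implicit.
Unset Printing Implicit Defensive.

Import Order.TTheory GRing.Theory Num.Theory.
Import numFieldNormedType.Exports.

Local Open Scope classical_set_scope.
Local Open Scope ring_scope.

Section schwartz_pred.
Variable R : realType.
Implicit Types f g : R -> R^o.

Definition is_schwartz f : Prop :=
  (forall (m : nat) (x : R), derivable (derive1n m f) x 1) /\
  (forall k m : nat, exists M : R,
    forall x : R, `|x ^+ k * derive1n m f x| <= M).

Definition schwartz_pred : {pred R -> R^o} := fun f => `[< is_schwartz f >].

Lemma derive1n_lin (a : R) f g :
  (forall m x, derivable (derive1n m f) x 1) ->
  (forall m x, derivable (derive1n m g) x 1) ->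
  forall m, derive1n m (a *: f + g) = a *: derive1n m f + derive1n m g.
Proof.
move=> df dg; elim=> [//|m IH]; rewrite !derive1nS IH; apply/funext => x.
have dZ : derivable (a *: derive1n m f) x 1 by apply: derivableZ; exact: df.
by rewrite derive1E (deriveD dZ (dg m x)) (deriveZ a (df m x)) -!derive1E.
Qed.

Fact schwartz_submod_closed : submod_closed schwartz_pred.
Proof.
split=> [|a f g /asboolP[df bf] /asboolP[dg bg]]; apply/asboolP.
  have d0 m : derive1n m (0 : R -> R^o) = 0.
    elim: m => [//|m IH]; rewrite derive1nS IH; apply/funext => x.
    by rewrite derive1E; exact: derive_cst.
  split=> [m x|k m]; first by rewrite d0; exact: derivable_cst.
  by exists 0 => x; rewrite d0 mulr0 normr0.
split=> [m x|k m]; rewrite derive1n_lin//.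
  by apply: derivableD; [apply: derivableZ; exact: df|exact: dg].
have [[M HM] [N HN]] := (bf k m, bg k m).
exists (`|a| * M + N) => x; rewrite mulrDr.
apply: (le_trans (ler_normD _ _)); apply: lerD; last exact: HN.
have -> : x ^+ k * (a *: derive1n m f) x = a * (x ^+ k * derive1n m f x).
  exact: mulrCA.
by rewrite normrM ler_wpM2l.
Qed.

HB.instance Definition _ :=
  GRing.isSubmodClosed.Build R (R -> R^o) schwartz_pred schwartz_submod_closed.

End schwartz_pred.

Record schwartz (R : realType) : Type :=
  Schwartz { schwartz_fun :> R -> R^o ; _ : schwartz_fun \in @schwartz_pred R }.

HB.instance Definition _ (R : realType) := [isSub for @schwartz_fun R].
HB.instance Definition _ (R : realType) := [Choice of schwartz R by <:].
HB.instance Definition _ (R : realType) :=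
  [SubChoice_isSubLmodule of schwartz R by <:].
HB.instance Definition _ (R : realType) := isPointed.Build (schwartz R) 0.

Definition schwartz_seminorm (R : realType) (k m : nat) (f : schwartz R) : R :=
  sup (range (fun x : R => `|x ^+ k * derive1n m f x|)).

(* The locally convex topology of the seminorms: the balls with arbitrary
   centres, indexed by (centre, k, m, radius), form a subbase. *)
HB.instance Definition _ (R : realType) :=
  @isSubBaseTopological.Build (schwartz R) (schwartz R * nat * nat * R)%type
    [set i | 0 < i.2]
    (fun i => [set f | schwartz_seminorm i.1.1.2 i.1.2 (f - i.1.1.1) < i.2]).

Section dual.
Variables (R : realType) (E : preTopologicalLmodType R).

Record dual : Type :=
  Dual { dual_fun :> {scalar E} ; _ : continuous (dual_fun : E -> R^o) }.

HB.instance Definition _ := gen_eqMixin dual.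
HB.instance Definition _ := gen_choiceMixin dual.

Fact dual0_continuous : continuous ((\0 : {scalar E}) : E -> R^o).
Proof. by move=> x; exact: cvg_cst. Qed.

HB.instance Definition _ := isPointed.Build dual (Dual dual0_continuous).

Definition cylinder : set (set dual) :=
  [set C | exists (n : nat) (xi : n.-tuple E) (B : set (n.-tuple R)),
    measurable B /\ C = [set x : dual | B [tuple x (tnth xi i) | i < n]]].

Definition cylinder_dual := g_sigma_algebraType cylinder.

End dual.

Definition tempered (R : realType) := cylinder_dual (schwartz R).

Section L2.
Variable R : realType.

Definition L2dot (f g : schwartz R) : R :=
  \int[@lebesgue_measure R]_x (f x * g x).

Definition L2norm (f : schwartz R) : R :=
  fine ('N[@lebesgue_measure R]_2%:E[EFin \o f])%E.

End L2.

Section special_functions.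
Variable R : realType.

Definition upper_gamma (rho x : R) : R :=
  \int[@lebesgue_measure R]_(w in `[x, +oo[) (expR (- w) * w `^ (rho - 1)).

(* For x <= 0, m is the least integer such that 0 < x + m and
   Gamma(x) = Gamma(x + m) / (x (x + 1) ... (x + m - 1)).  At the poles
   x = 0, -1, -2, ... the denominator is 0, so that Gamma x = 0 and
   (Gamma x)^-1 = 0, the convention used for 1/Gamma. *)
Definition Gamma (x : R) : R :=
  if 0 < x then upper_gamma x 0
  else let m := (Num.truncn (- x)).+1 in
    upper_gamma (x + m%:R) 0 / \prod_(i < m) (x + i%:R).

Definition pochhammer (g : R) (j : nat) : R := Gamma (g + j%:R) / Gamma g.

Definition prabhakar (alpha beta g x : R) : R :=
  limn (series (fun j : nat =>
    pochhammer g j * x ^+ j / (j`!%:R * Gamma (alpha * j%:R + beta)))).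

Definition cexp (z : R[i]) : R[i] :=
  real_complex R (expR (complex.Re z)) * Complex (cos (complex.Im z)) (sin (complex.Im z)).

End special_functions.

Definition cintegral d (T : measurableType d) (R : realType)
    (mu : {measure set T -> \bar R}) (f : T -> R[i]) : R[i] :=
  Complex (\int[mu]_x complex.Re (f x)) (\int[mu]_x complex.Im (f x)).

Definition is_gamma_grey (R : realType) (rho theta : R)
    (nu : probability (tempered R) R) : Prop :=
  forall xi : schwartz R,
    cintegral nu (fun x => cexp (Complex 0 1 * real_complex R (x xi))) =
    real_complex R
      (upper_gamma rho (theta + 2^-1 * L2dot xi xi) / upper_gamma rho theta).

(* Main.v *)
(* The characteristic function of <., xi> is g(t^2 <xi, xi> / 2) with
   g(u) = Gamma(rho, theta + u) / Gamma(rho, theta), so all moments are read off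
   its Taylor coefficients at 0; since g'(u) is proportional to
   w^(rho-1) e^(-w) at w = theta + u, differentiating the power series of the
   latter termwise produces the Prabhakar function.  That the moments exist, and
   agree with the Taylor coefficients, comes from the n-th iterate of the second
   difference D f(t) = 2 f(t) - f(t+1) - f(t-1): applied to
   t |-> E cos(t h X) it gives E [cos(t h X) (2 - 2 cos(h X))^n], and
   ((2 - 2 cos(h X)) / h^2)^n is dominated by X^(2n) and tends to it as h -> 0.
   Fatou's lemma bounds E X^(2n), dominated convergence computes it, and the
   same kernel multiplied by sin(h X) / h kills the odd moments. *)
Require Import Defs.
From mathcomp Require Import all_boot all_order all_algebra complex ring lra.
From mathcomp Require Import all_classical all_reals all_analysis measurable_realfun.

Set Implicit Arguments.
Unset Strict Implicit.
Unset Printing Implicit Defensive.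

Import Order.TTheory GRing.Theory Num.Theory.
Import numFieldNormedType.Exports.

Local Open Scope classical_set_scope.
Local Open Scope ring_scope.

(** * Second differences *)

Definition second_difference (R : pzRingType) (f : R -> R) (t : R) : R :=
  2 * f t - f (t + 1) - f (t - 1).

Section second_difference.
Variable R : realFieldType.
Implicit Types (f g : R -> R) (t : R).

Lemma iter_second_difference0 n t :
  iter n (@second_difference R) (fun=> 0) t = 0.
Proof.
suff -> : iter n (@second_difference R) (fun=> 0) = (fun=> 0) by [].
elim: n => //= n ->; apply/funext => u.
by rewrite /second_difference mulr0 !subr0.
Qed.

Lemma iter_second_differenceD n f g t :
  iter n (@second_difference R) (fun x => f x + g x) t =
  iter n (@second_difference R) f t + iter n (@second_difference R) g t.
Proof. by elim: n t => //= n IH t; rewrite /second_difference !IH; ring. Qed.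

Lemma iter_second_differenceZ n (c : R) f t :
  iter n (@second_difference R) (fun x => c * f x) t =
  c * iter n (@second_difference R) f t.
Proof. by elim: n t => //= n IH t; rewrite /second_difference !IH; ring. Qed.

Lemma iter_second_difference_sum n (I : Type) (r : seq I) (P : pred I)
    (F : I -> R -> R) t :
  iter n (@second_difference R) (fun x => \sum_(i <- r | P i) F i x) t =
  \sum_(i <- r | P i) iter n (@second_difference R) (F i) t.
Proof.
elim: r t => [|i r IH] t.
  rewrite big_nil -[RHS](iter_second_difference0 n t).
  by congr (iter _ _ _ _); apply/funext => u; rewrite big_nil.
rewrite big_cons; case: ifP => Pi.
  rewrite -IH -iter_second_differenceD.
  by congr (iter _ _ _ _); apply/funext => u; rewrite big_cons Pi.
rewrite -IH; congr (iter _ _ _ _).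
by apply/funext => u; rewrite big_cons Pi.
Qed.

(** The coefficients of a second difference have absolute sum 4, and n of them taken at [t] only see
    points within distance n of [t]. This will control the Taylor remainder. *)
Lemma norm_iter_second_difference_le n f (B M : R) :
  (forall t, `|t| <= M + n%:R -> `|f t| <= B) ->
  forall t, `|t| <= M -> `|iter n (@second_difference R) f t| <= 4 ^+ n * B.
Proof.
elim: n M => [|n IH] M fB t tM; first by rewrite expr0 mul1r; apply: fB; rewrite addr0.
have IH' u : `|u| <= M + 1 -> `|iter n (@second_difference R) f u| <= 4 ^+ n * B.
  by apply: IH => v vM; apply: fB; rewrite -natr1; lra.
have := IH' t; have := IH' (t + 1); have := IH' (t - 1).
have := ler_normD t 1; have := ler_normB t 1; rewrite normr1 iterS => h1 h2 h3 h4 h5.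
have {}h3 := h3 ltac:(lra); have {}h4 := h4 ltac:(lra); have {}h5 := h5 ltac:(lra).
rewrite /second_difference exprS mulr_natl mulr2n.
apply: (le_trans (ler_normB _ _)); have := ler_normB
  (iter n (@second_difference R) f t + iter n (@second_difference R) f t)
  (iter n (@second_difference R) f (t + 1)).
have := ler_normD (iter n (@second_difference R) f t) (iter n (@second_difference R) f t).
lra.
Qed.

(** The terms of degree d+2 and d+1 cancel in the binomial expansions at t+1 and t-1. The index i
    counts downwards from degree d; the terms with odd i vanish but stay in the sum. *)
Lemma second_difference_exp d t : second_difference (fun x => x ^+ d.+2) t =
  - \sum_(i < d.+1) ('C(d.+2, i.+2)%:R * (1 + (-1) ^+ i)) * t ^+ (d - i).
Proof.
have exprD2 (c : R) : (t + c) ^+ d.+2 = t ^+ d.+2 + d.+2%:R * c * t ^+ d.+1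
    + \sum_(i < d.+1) 'C(d.+2, i.+2)%:R * c ^+ i.+2 * t ^+ (d - i).
  rewrite exprDn 2!big_ord_recl addrA; congr (_ + _ + _).
  - by rewrite subn0 expr0 bin0 mulr1 mulr1n.
  - by rewrite /bump /= bin1 -mulr_natl; ring.
  - by apply: eq_bigr => i _; rewrite !lift0 -mulr_natl !subSS; ring.
rewrite /second_difference !exprD2.
have -> : \sum_(i < d.+1) ('C(d.+2, i.+2)%:R * (1 + (-1) ^+ i)) * t ^+ (d - i) =
  \sum_(i < d.+1) 'C(d.+2, i.+2)%:R * 1 ^+ i.+2 * t ^+ (d - i) +
  \sum_(i < d.+1) 'C(d.+2, i.+2)%:R * (-1) ^+ i.+2 * t ^+ (d - i).
  rewrite -big_split /=; apply: eq_bigr => i _.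
  by rewrite expr1n !exprS; ring.
by ring.
Qed.

(* A second difference lowers the degree by 2, so that n of them annihilate the
   monomials of degree < 2n. *)
Lemma iter_second_difference_exp n d t : (d <= n.*2)%N ->
  iter n (@second_difference R) (fun x => x ^+ d) t =
  if d == n.*2 then (-1) ^+ n * (n.*2)`!%:R else 0.
Proof.
elim: n d t => [|n IH] d t; first by rewrite leqn0 => /eqP ->; rewrite !expr0 mul1r.
rewrite iterSr => dn.
have [d2|] := ltnP d 2.
  rewrite ifF; last by apply/eqP => h; move: d2; rewrite h doubleS.
  rewrite -[RHS](iter_second_difference0 n t); congr (iter _ _ _ _).
  apply/funext => u; rewrite /second_difference.
  by case: d d2 {dn} => [|[|//]] _; rewrite ?expr0 ?expr1; ring.
case: d dn => [|[|d]] // dn _; rewrite doubleS !eqSS.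
move: dn; rewrite doubleS !ltnS => dn.
rewrite (_ : second_difference _ = (fun u => \sum_(i < d.+1)
    (- ('C(d.+2, i.+2)%:R * (1 + (-1) ^+ i))) * u ^+ (d - i))); last first.
  apply/funext => u; rewrite second_difference_exp -sumrN.
  by apply: eq_bigr => i _; rewrite mulNr.
(* Only the leading term i = 0 can survive: for i > 0 the degree [d - i] is below 2n. *)
rewrite iter_second_difference_sum big_ord_recl big1 ?addr0; last first.
  move=> i _; rewrite iter_second_differenceZ IH; last exact: leq_trans (leq_subr _ _) dn. 
  rewrite ifF ?mulr0//; apply/eqP => h; move: dn; rewrite -h /=.
  by rewrite leqNgt ltn_subrL /= (leq_ltn_trans _ (ltn_ord i)).
rewrite iter_second_differenceZ /= subn0 IH//.
case: eqP => [->|_]; last by rewrite mulr0.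
(* The leading coefficient 2 C(2n+2, 2) = (2n+2)(2n+1) turns (2n)! into (2n+2)!. *)
rewrite bin2 /= expr0 [in RHS]factS [(_.+1)`!]factS !natrM exprS.
have -> : (n.*2.+2 * n.*2.+1)./2%:R = (n.+1)%:R * n.*2.+1%:R :> R.
  by rewrite -natrM -doubleS -doubleMl doubleK.
have -> : n.*2.+2%:R = 2 * n.+1%:R :> R by rewrite -natrM mul2n doubleS.
ring.
Qed.

End second_difference.

(** * Elementary bounds and limits for sine and cosine *)

Section sine_bounds.
Variable R : realType.
Implicit Types (x y : R).

Lemma norm_sin_le x : `|sin x| <= `|x|.
Proof.
wlog x0 : x / 0 <= x => [H|].
  by have [/H //|/ltW x0] := leP 0 x; rewrite -normrN -sinN -[leRHS]normrN H ?oppr_ge0.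
have [c _] := @MVT_segment R sin cos 0 x x0 (fun y _ => is_derive_sin y)
  (continuous_subspaceT (@continuous_sin R)).
rewrite sin0 !subr0 => ->.
by rewrite normrM -[leRHS]mul1r ler_wpM2r// cos_max.
Qed.

Lemma two_sub_two_cosE x : 2 - 2 * cos x = (2 * sin (x / 2)) ^+ 2.
Proof.
rewrite [X in cos X](_ : x = (x / 2) *+ 2); last by rewrite -mulr_natr divfK.
rewrite cos_mulr2n exprMn sin2cos2; ring.
Qed.

Lemma two_sub_two_cos_le x : 2 - 2 * cos x <= x ^+ 2.
Proof.
rewrite two_sub_two_cosE -[leRHS]real_normK ?num_real// -[leLHS]real_normK ?num_real//.
rewrite lerXn2r ?nnegrE// normrM ger0_norm//.
have := norm_sin_le (x / 2); rewrite normrM [`|2^-1|]ger0_norm//; lra.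
Qed.

Lemma two_sub_two_cos_ge0 x : 0 <= 2 - 2 * cos x.
Proof. by rewrite two_sub_two_cosE sqr_ge0. Qed.

Lemma cvg_sin_div x : sin (h * x) / h @[h --> 0^'] --> x.
Proof.
have d0 : is_derive (0 : R) 1 (fun h => sin (h * x)) x.
  apply: is_derive_eq; rewrite !mul0r cos0 /GRing.scale /= !(mulr1, mul1r).
  by rewrite mulr0 add0r.
have -> : (fun h => sin (h * x) / h) =
    (fun h : R => h^-1 *: (sin ((h *: 1 + 0) * x) - sin (0 * x))).
  apply/funext => h.
  by rewrite mul0r sin0 subr0 addr0 /GRing.scale /= mulr1 mulrC.
rewrite -[X in _ --> X](@derive_val _ _ _ _ _ _ _ d0).
exact: (@ex_derive _ _ _ _ _ _ _ d0).
Qed.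

Lemma cvg_two_sub_two_cos_div x :
  (2 - 2 * cos (h * x)) / h ^+ 2 @[h --> 0^'] --> x ^+ 2.
Proof.
rewrite (_ : x ^+ 2 = (2 * (x / 2)) ^+ 2); last by rewrite mulrC divfK.
rewrite (_ : (fun h => _) = (fun h => (2 * (sin (h * (x / 2)) / h)) ^+ 2)).
  apply: (@cvg_comp _ _ _ (fun h => 2 * (sin (h * (x / 2)) / h)) (fun y => y ^+ 2)).
    by apply: cvgMr; exact: cvg_sin_div.
  exact: exprn_continuous.
apply/funext => h; rewrite two_sub_two_cosE -exprVn -exprMn mulrA; congr (_ ^+ 2).
by rewrite -!mulrA.
Qed.

End sine_bounds.

(** * Moments from the characteristic function *)

Section characteristic_function_moments.
Context d (T : measurableType d) (R : realType) (P : probability T R).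
Variable X : T -> R.
Hypothesis mX : measurable_fun setT X.

Let measurable_scaled (c : R) : measurable_fun setT (fun x => c * X x).
Proof. exact: measurable_funM. Qed.

Let integrable_bounded (f : T -> R) (M : R) : measurable_fun setT f ->
  (forall x, `|f x| <= M) -> P.-integrable setT (EFin \o f).
Proof.
move=> mf fM; apply: measurable_bounded_integrable => //.
  exact: le_lt_trans (probability_le1 P measurableT) (ltry 1).
exists M; split; first by rewrite num_real.
by move=> N MN x _; exact: le_trans (fM x) (ltW MN).
Qed.

(** By the product-to-sum identity, each second difference in t puts a factor 2 - 2 cos(hX) under
    the integral. Cosine and sine both satisfy that identity; the former serves the even moments,
    the latter the odd ones. *)
Lemma integral_second_difference (g : R -> R) (n : nat) (h t : R) :
  continuous g -> (forall a, `|g a| <= 1) ->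
  (forall a b, g (a + b) + g (a - b) = 2 * (g a * cos b)) ->
  \int[P]_x (g (t * (h * X x)) * (2 - 2 * cos (h * X x)) ^+ n) =
  iter n (@second_difference R) (fun u => \int[P]_x g (u * h * X x)) t.
Proof.
move=> cg g1 gD; elim: n t => [|n IH] t.
  by rewrite /=; apply: eq_Rintegral => x _; rewrite expr0 mulr1 mulrA.
rewrite iterS {1}/second_difference -!IH.
have mg u : measurable_fun setT (fun x => g (u * (h * X x)) * (2 - 2 * cos (h * X x)) ^+ n).
  apply: measurable_funM.
    apply: (measurableT_comp (continuous_measurable_fun cg)).
    by apply: measurable_funM => //; exact: measurable_scaled.
  apply: measurable_funX; apply: measurable_funB => //.
  apply: measurable_funM => //.
  apply: (measurableT_comp (continuous_measurable_fun (@continuous_cos R))).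
  exact: measurable_scaled.
have ig u : P.-integrable setT
    (EFin \o (fun x => g (u * (h * X x)) * (2 - 2 * cos (h * X x)) ^+ n)).
  apply: (@integrable_bounded _ (4 ^+ n)) => // x.
  rewrite normrM -[leRHS]mul1r ler_pM// normrX lerXn2r ?nnegrE//.
  have := cos_max (h * X x); rewrite !ler_norml; lra.
have ig2 : P.-integrable setT
    (EFin \o (fun x => 2 * (g (t * (h * X x)) * (2 - 2 * cos (h * X x)) ^+ n))).
  exact: (integrableZl measurableT 2 (ig t)).
rewrite -RintegralZl// -RintegralB// -RintegralB//; last first.
  exact: (integrableB _ ig2 (ig (t + 1))).
apply: eq_Rintegral => x _.
have e : g ((t + 1) * (h * X x)) + g ((t - 1) * (h * X x)) =
    2 * (g (t * (h * X x)) * cos (h * X x)).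
  by rewrite -gD; congr (g _ + g _); ring.
transitivity ((2 * g (t * (h * X x)) - 2 * (g (t * (h * X x)) * cos (h * X x)))
  * (2 - 2 * cos (h * X x)) ^+ n); first by rewrite exprS; ring.
by rewrite -e; ring.
Qed.


(** Fatou's lemma and dominated convergence are applied along sequences, and the kernel below
    divides by h: for delta > 0 these steps tend to 0 without reaching it. *)
Let steps (delta : R) (i : nat) : R := delta / i.+1%:R.

Let steps_cvg (delta : R) : 0 < delta -> steps delta @ \oo --> (0 : R)^'.
Proof.
move=> d0; have s0 i : steps delta i != 0 by rewrite lt0r_neq0// divr_gt0.
have h : steps delta @ \oo --> (0 : R).
  rewrite -[X in _ --> X](mulr0 delta); apply: cvgMr.
  exact: cvg_harmonic.
move=> A /h /= [N _ hA]; exists N => // i /hA /=; apply; exact: s0.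
Qed.

Let kernel (n : nat) (h : R) (x : T) : R := ((2 - 2 * cos (h * X x)) / h ^+ 2) ^+ n.

Let kernel_le n (h : R) x : h != 0 -> 0 <= kernel n h x <= X x ^+ n.*2.
Proof.
move=> h0; have h2 : 0 < h ^+ 2 by rewrite exprn_even_gt0.
have k0 : 0 <= (2 - 2 * cos (h * X x)) / h ^+ 2.
  by rewrite divr_ge0 ?two_sub_two_cos_ge0// ltW.
rewrite exprn_ge0//= -mul2n exprM lerXn2r ?nnegrE ?sqr_ge0//.
rewrite ler_pdivrMr// -exprMn [X in _ <= X ^+ 2]mulrC.
exact: two_sub_two_cos_le.
Qed.

Let kernel_cvg n (delta : R) x : 0 < delta ->
  kernel n (steps delta i) x @[i --> \oo] --> X x ^+ n.*2.
Proof.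
move=> d0; rewrite -mul2n exprM.
apply: (@cvg_comp _ _ _ (fun i => (2 - 2 * cos (steps delta i * X x)) / steps delta i ^+ 2)
  (fun y => y ^+ n)); last exact: exprn_continuous.
exact: (cvg_comp _ _ (steps_cvg d0) (@cvg_two_sub_two_cos_div R (X x))).
Qed.

Let measurable_kernel n h : measurable_fun setT (kernel n h).
Proof.
apply: measurable_funX; apply: measurable_funM => //; apply: measurable_funB => //.
apply: measurable_funM => //.
apply: (measurableT_comp (continuous_measurable_fun (@continuous_cos R))).
exact: measurable_scaled.
Qed.

Let integrable_kernel n (h : R) : h != 0 -> P.-integrable setT (EFin \o kernel n h).
Proof.
move=> h0; apply: (@integrable_bounded _ ((4 / h ^+ 2) ^+ n)) => // x.
have h2 : 0 < h ^+ 2 by rewrite exprn_even_gt0.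
rewrite /kernel normrX lerXn2r ?nnegrE ?divr_ge0 ?(ltW h2)//.
rewrite ger0_norm ?divr_ge0 ?two_sub_two_cos_ge0 ?(ltW h2)//.
rewrite ler_pdivrMr// divfK ?gt_eqF//; have := cos_geN1 (h * X x); lra.
Qed.

Let integral_kernel n (h : R) : h != 0 -> \int[P]_x kernel n h x =
  iter n (@second_difference R) (fun u => \int[P]_x cos (u * h * X x)) 0 / h ^+ n.*2.
Proof.
move=> h0; rewrite -integral_second_difference//; last 3 first.
- exact: continuous_cos.
- exact: cos_max.
- by move=> a b; rewrite cosD cosB; ring.
rewrite mulrC -RintegralZl//; last first.
  have := integrable_kernel n h0 => /(integrableZl measurableT (h ^+ n.*2)).
  congr (_ .-integrable _ _); apply/funext => x /=.
  rewrite mul0r cos0 mul1r -EFinM /kernel expr_div_n -exprM mul2n.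
  by rewrite mulrC divfK// expf_neq0.
apply: eq_Rintegral => x _.
by rewrite mul0r cos0 mul1r /kernel expr_div_n -exprM mul2n mulrC.
Qed.

(** At scale h the n-th iterate removes the monomials of degree below 2n, turns the top one into
    (-1)^n (2n)! [a n] h^(2n), and leaves an error of order h^(2n+2). Division by h^(2n) gives the
    limit of the kernel integrals. *)
Lemma even_moment (a : nat -> R) (n : nat) (C delta : R) : 0 < delta ->
  (forall t, `|t| <= delta ->
     `|\int[P]_x cos (t * X x) - \sum_(m < n.+1) a m * t ^+ m.*2| <= C * t ^+ n.*2.+2) ->
  P.-integrable setT (EFin \o (fun x => X x ^+ n.*2)) /\
  \int[P]_x (X x ^+ n.*2) = (-1) ^+ n * n.*2`!%:R * a n.
Proof.
move=> d0 phiE.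
(* The n second differences at 0 with step h reach as far as n h; starting from delta / (n+1) keeps
   this within [delta]. *)
pose h := steps (delta / n.+1%:R).
have d1 : 0 < delta / n.+1%:R by rewrite divr_gt0.
have h0 i : h i != 0 by rewrite lt0r_neq0// !divr_gt0.
pose c := (-1) ^+ n * n.*2`!%:R * a n.
have cvgI : \int[P]_x kernel n (h i) x @[i --> \oo] --> c.
  have kI i : `|\int[P]_x kernel n (h i) x - c| <=
      4 ^+ n * (`|C| * n%:R ^+ n.*2.+2) * h i ^+ 2.
    rewrite integral_kernel//.
    pose r t := \int[P]_x cos (t * X x) - \sum_(m < n.+1) a m * t ^+ m.*2.
    (* Substituting t = u h moves the powers of h into the coefficients, so that second differences
       of unit step in u apply. *)
    rewrite (_ : (fun u => _) = (fun u => r (u * h i) +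
        \sum_(m < n.+1) (a m * h i ^+ m.*2) * u ^+ m.*2)); last first.
      apply/funext => u; rewrite /r -[LHS](subrK (\sum_(m < n.+1) a m * (u * h i) ^+ m.*2)).
      congr (_ + _); apply: eq_bigr => m _; rewrite exprMn; ring.
    rewrite iter_second_differenceD iter_second_difference_sum.
    rewrite big_ord_recr big1 /=; last first.
      move=> m _; rewrite iter_second_differenceZ iter_second_difference_exp.
        by rewrite (inj_eq double_inj) ltn_eqF ?mulr0.
      by rewrite leq_double ltnW.
    rewrite iter_second_differenceZ iter_second_difference_exp// eqxx add0r.
    rewrite mulrDl (_ : _ * _ / _ = c); last first.
      by rewrite mulrC [a n * _]mulrC -!mulrA mulKf ?expf_neq0// mulrC.
    rewrite addrK normrM normfV.
    have hE : `|h i ^+ n.*2| = h i ^+ n.*2.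
      by rewrite ger0_norm// exprn_ge0// divr_ge0// ltW.
    rewrite hE ler_pdivrMr; last by rewrite exprn_gt0// divr_gt0.
    have -> : 4 ^+ n * (`|C| * n%:R ^+ n.*2.+2) * h i ^+ 2 * h i ^+ n.*2 =
        4 ^+ n * (`|C| * (n%:R * h i) ^+ n.*2.+2).
      by rewrite [(n%:R * _) ^+ _]exprMn [h i ^+ n.*2.+2]exprS [h i ^+ n.*2.+1]exprS; ring.
    apply: (@norm_iter_second_difference_le _ _ _ _ 0); last by rewrite normr0.
    move=> u; rewrite add0r => un.
    have hi : 0 < h i by rewrite divr_gt0.
    have uh : `|u * h i| <= n%:R * h i by rewrite normrM (gtr0_norm hi) ler_pM2r.
    apply: le_trans (phiE _ _) _.
      apply: le_trans uh _.
      have -> : n%:R * h i = delta * (n%:R / n.+1%:R / i.+1%:R) by rewrite /h /steps; ring.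
      rewrite ler_piMr ?(ltW d0)// !ler_pdivrMr// mul1r -natrM ler_nat.
      by rewrite mulSn (leq_trans (leqnSn n))// leq_addr.
    apply: le_trans (ler_norm _) _; rewrite normrM ler_wpM2l// normrX.
    by rewrite lerXn2r ?nnegrE// mulr_ge0// ltW.
  pose K := 4 ^+ n * (`|C| * n%:R ^+ n.*2.+2).
  have hK (s : R) : c + s * (K * h i ^+ 2) @[i --> \oo] --> c.
    rewrite [X in _ --> X](_ : c = c + s * (K * 0 ^+ 2)); last by rewrite expr0n !mulr0 addr0.
    apply: cvgD; first exact: cvg_cst.
    apply: cvgMr; apply: cvgMr.
    apply: (@cvg_comp _ _ _ h (fun y => y ^+ 2)); last exact: exprn_continuous.
    exact: (cvg_trans (steps_cvg d1) (cvg_within _)).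
  apply: (squeeze_cvgr _ (hK (-1)) (hK 1)).
  by apply: nearW => i; have := kI i; rewrite ler_norml /K; lra.
have cvgIE : (\int[P]_x (kernel n (h i) x)%:E)%E @[i --> \oo] --> c%:E.
  rewrite [X in X @ _ --> _](_ : _ = EFin \o (fun i => \int[P]_x kernel n (h i) x)).
    by apply: cvg_EFin => //; exact: nearW.
  apply/funext => i /=; rewrite /Rintegral fineK//.
  exact: integrable_fin_num (integrable_kernel n (h0 i)).
have kE x : (fun i => (kernel n (h i) x)%:E) @ \oo --> (X x ^+ n.*2)%:E.
  by apply: cvg_EFin; [exact: nearW|exact: kernel_cvg].
have mXn : measurable_fun setT (fun x => X x ^+ n.*2) by exact: measurable_funX.
have iX : P.-integrable setT (EFin \o (fun x => X x ^+ n.*2)).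
  apply/integrableP; split; first exact/measurable_EFinP.
  (* The lower limit of the kernels is X^(2n), and that of their integrals is the finite number
     [c]. *)
  have := @fatou _ _ _ P setT measurableT (fun i x => (kernel n (h i) x)%:E).
  move=> /(_ _ _)/wrap[].
    by move=> i; exact/measurable_EFinP.
    by move=> i x _; rewrite lee_fin; have /andP[] := kernel_le n x (h0 i).
  rewrite (cvg_limn_einf_sup cvgIE).1 => fat; apply: le_lt_trans (le_trans _ fat) (ltry c).
  rewrite le_eqVlt; apply/orP; left; apply/eqP; apply: eq_integral => x _ /=.
  rewrite (cvg_limn_einf_sup (kE x)).1 ger0_norm// -mul2n exprM exprn_ge0// sqr_ge0.
split => //.
(* X^(2n) is at once the pointwise limit and the dominating function. *)
have [|||||_ _ cvgX] := @dominated_convergence _ _ _ P setT measurableT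
  (fun i x => (kernel n (h i) x)%:E) (EFin \o (fun x => X x ^+ n.*2))
  (EFin \o (fun x => X x ^+ n.*2)).
- by move=> i; exact/measurable_EFinP.
- exact/measurable_EFinP.
- by apply: aeW => x _; exact: kE.
- exact: iX.
- apply: aeW => x i _; have /andP[k0 kX] := kernel_le n x (h0 i).
  by rewrite lee_fin ger0_norm.
by rewrite /Rintegral (cvg_unique _ cvgX cvgIE).
Qed.

(** The odd power is dominated by the sum of its two even neighbours, because |y| <= 1 + y^2. Its
    integral is a limit of rescaled iterated second differences of t |-> E sin(tX), which is
    identically zero. *)
Lemma odd_moment (n : nat) :
  (forall t, \int[P]_x sin (t * X x) = 0) ->
  P.-integrable setT (EFin \o (fun x => X x ^+ n.*2)) ->
  P.-integrable setT (EFin \o (fun x => X x ^+ n.*2.+2)) ->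
  P.-integrable setT (EFin \o (fun x => X x ^+ n.*2.+1)) /\
  \int[P]_x (X x ^+ n.*2.+1) = 0.
Proof.
move=> sin0 i0 i2.
have even_ge0 x : 0 <= X x ^+ n.*2 by rewrite -mul2n exprM exprn_ge0// sqr_ge0.
have i1 : P.-integrable setT (EFin \o (fun x => X x ^+ n.*2.+1)).
  apply: le_integrable (integrableD measurableT i0 i2) => //.
    by apply/measurable_EFinP; exact: measurable_funX.
  move=> x _ /=; rewrite lee_fin.
  rewrite (_ : _ + _ = X x ^+ n.*2 * (1 + X x ^+ 2)); last by rewrite !exprS; ring.
  rewrite exprSr !normrM ler_wpM2l// [leRHS]ger0_norm; last first.
    by rewrite addr_ge0// sqr_ge0.
  rewrite -[X x ^+ 2]real_normK ?num_real//.
  by have := sqr_ge0 (`|X x| - 1); have := normr_ge0 (X x); rewrite !expr2; nra.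
split=> //.
pose h := steps 1; have h0 i : h i != 0 by rewrite lt0r_neq0// divr_gt0.
pose f i x := sin (h i * X x) / h i * kernel n (h i) x.
have mf i : measurable_fun setT (f i).
  apply: measurable_funM => //; apply: measurable_funM => //.
  apply: (measurableT_comp (continuous_measurable_fun (@continuous_sin R))).
  exact: measurable_scaled.
have f_le i x : `|f i x| <= `|X x ^+ n.*2.+1|.
  have /andP[k0 kX] := kernel_le n x (h0 i).
  rewrite /f exprS normrM [leRHS]normrM ler_pM//.
    rewrite normrM normfV ler_pdivrMr ?normr_gt0//.
    by apply: le_trans (norm_sin_le _) _; rewrite normrM mulrC.
  by rewrite !ger0_norm.
have int_f i : \int[P]_x f i x = 0.
  (* The second differences are taken at t = 1 here, since at t = 0 the factor sin(t h X) would be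
     lost. *)
  have e : \int[P]_x (sin (1 * (h i * X x)) * (2 - 2 * cos (h i * X x)) ^+ n) = 0.
    rewrite integral_second_difference.
    - rewrite -[RHS](iter_second_difference0 n 1); congr (iter _ _ _ _).
      by apply/funext => u; exact: sin0.
    - exact: continuous_sin.
    - exact: sin_max.
    - move=> a b; rewrite sinD sinB; ring.
  rewrite -[RHS](mulr0 (h i ^+ n.*2.+1)^-1) -[in RHS]e -RintegralZl//.
    apply: eq_Rintegral => x _; rewrite /f /kernel mul1r expr_div_n -exprM mul2n exprS.
    rewrite [(h i * h i ^+ _)^-1]invfM.
    by ring.
  apply: (@integrable_bounded _ (4 ^+ n)).
    apply: measurable_funM.
      apply: (measurableT_comp (continuous_measurable_fun (@continuous_sin R))).
      by apply: measurable_funM => //; exact: measurable_scaled.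
    apply: measurable_funX; apply: measurable_funB => //.
    apply: measurable_funM => //.
    apply: (measurableT_comp (continuous_measurable_fun (@continuous_cos R))).
    exact: measurable_scaled.
  move=> x; rewrite normrM -[leRHS]mul1r ler_pM ?sin_max// normrX lerXn2r ?nnegrE//.
  have := cos_max (h i * X x); rewrite !ler_norml; lra.
have [|||||_ _ cvgX] := @dominated_convergence _ _ _ P setT measurableT
  (fun i x => (f i x)%:E) (EFin \o (fun x => X x ^+ n.*2.+1))
  (fun x => (`|X x ^+ n.*2.+1|)%:E).
- by move=> i; exact/measurable_EFinP.
- by apply/measurable_EFinP; exact: measurable_funX.
- apply: aeW => x _; apply: cvg_EFin; first exact: nearW.
  rewrite exprS.
  have c1 : sin (h i * X x) / h i @[i --> \oo] --> X x.
    exact: (cvg_comp _ _ (steps_cvg ltr01) (@cvg_sin_div R (X x))).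
  have c2 : kernel n (h i) x @[i --> \oo] --> X x ^+ n.*2 by exact: kernel_cvg.
  have c3 := cvgM c1 c2.
  exact: c3.
- exact: (integrable_abse i1).
- by apply: aeW => x i _; rewrite /= lee_fin.
rewrite /Rintegral (cvg_unique _ cvgX (_ : _ --> (0 : \bar R)))//.
rewrite [X in X @ _ --> _](_ : _ = fun=> 0%E); first exact: cvg_cst.
apply/funext => i; rewrite /= -[RHS]/(0%:E) -(int_f i) /Rintegral fineK//.
apply: integrable_fin_num => //.
apply: le_integrable i1 => //; first exact/measurable_EFinP.
by move=> x _; rewrite /= lee_fin.
Qed.

End characteristic_function_moments.

(** Induction on the order, for the shifted family: the remainder of order N+1 vanishes at 0 and its
    derivative is the remainder of order N of [K 1], so the mean value theorem gains a factor u.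
    Order 0 is boundedness of a continuous function on [a, a+1]. *)
Lemma taylor_bound (R : realType) (K : nat -> R -> R) (a : R) :
  0 < a -> (forall m (w : R), 0 < w -> is_derive w 1 (K m) (K m.+1 w)) ->
  forall N, exists C : R, forall u : R, 0 <= u <= 1 ->
    `|K 0%N (a + u) - \sum_(m < N) K m a / m`!%:R * u ^+ m| <= C * u ^+ N.
Proof.
move=> a0 + N; elim: N K => [|N IH] K dK.
  have cK : {within `[a, a + 1], continuous (fun w => `|K 0%N w|)}.
    apply: continuous_in_subspaceT => w; rewrite inE /= in_itv /= => /andP[aw _].
    apply: (continuous_comp _ (@norm_continuous _ _ _)).
    apply/differentiable_continuous/derivable1_diffP.
    exact: (@ex_derive _ _ _ _ _ _ _ (dK 0%N w (lt_le_trans a0 aw))).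
  have [|c _ hc] := EVT_max _ cK; first by rewrite lerDl.
  exists `|K 0%N c| => u /andP[u0 u1]; rewrite big_ord0 subr0 mulr1.
  by apply: hc; rewrite in_itv /= lerDl lerD2l u0.
have [C hC] := IH (fun m => K m.+1) (fun m => dK m.+1).
exists `|C| => U /andP[U0 U1].
pose F u := K 0%N (a + u) - \sum_(m < N.+1) K m a / m`!%:R * u ^+ m.
pose dF u := K 1%N (a + u) - \sum_(m < N) K m.+1 a / m`!%:R * u ^+ m.
have derF (u : R) : 0 <= u -> is_derive u 1 F (dF u).
  move=> u0; apply: is_deriveB.
    have au : 0 < a + u by rewrite ltr_wpDr.
    have da : is_derive u 1 (fun u => a + u) 1 
      by have := is_deriveD (is_derive_cst a u 1) (is_derive_id u 1); rewrite add0r.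
    have := @is_derive1_comp _ (K 0%N) (fun u => a + u) u _ _ (dK 0%N _ au) da.
    by rewrite mulr1.
  rewrite (_ : (fun u => _) = \sum_(m < N.+1) (fun u => K m a / m`!%:R * u ^+ m)); last first.
    by apply/funext => v; rewrite fct_sumE.
  rewrite (_ : \sum_(m < N) _ =
      \sum_(m < N.+1) (K m a / m`!%:R * (m%:R * u ^+ m.-1))); last first.
    rewrite big_ord_recl /= mul0r mulr0 add0r; apply: eq_bigr => i _.
    rewrite /bump /= add1n factS natrM; field.
    by rewrite pnatr_eq0 -lt0n fact_gt0 nat1r pnatr_eq0.
  apply: is_derive_sum => m.
  have dX : is_derive u 1 (fun u : R => u ^+ m) (m%:R * u ^+ m.-1).
    by split; [exact: exprn_derivable|rewrite exp_derive [LHS]mulr1].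
  exact: (is_deriveZ (K m a / m`!%:R) dX).
have F0 : F 0 = 0.
  rewrite /F addr0 big_ord_recl big1 => [|i _]; last by rewrite /= exprS mul0r mulr0.
  by rewrite /= expr0 mulr1 addr0 fact0 divr1 subrr.
have [||c] := @MVT_segment R F dF 0 U U0.
- by move=> u; rewrite in_itv /= => /andP[/ltW u0 _]; exact: derF.
- apply: continuous_in_subspaceT => u; rewrite inE /= in_itv /= => /andP[u0 _].
  apply/differentiable_continuous/derivable1_diffP.
  exact: (@ex_derive _ _ _ _ _ _ _ (derF u u0)).
rewrite in_itv /= -[X in _ -> _ -> `|X| <= _]/(F U) => /andP[c0 cU]; rewrite F0 !subr0 => ->.
rewrite normrM (ger0_norm U0) exprSr mulrA ler_wpM2r//.
apply: le_trans (hC c _) _; first by rewrite c0 (le_trans cU).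
apply: le_trans (ler_norm _) _; rewrite normrM normrX (ger0_norm c0) ler_wpM2l//.
by rewrite lerXn2r ?nnegrE.
Qed.

(** * The Gamma function *)

Section gamma_integral.
Variable R : realType.
Implicit Types (x w : R).
Local Notation mu := (@lebesgue_measure R).

Definition gamma_kernel x w : R := expR (- w) * w `^ (x - 1).

Lemma gamma_kernel_ge0 x w : 0 <= gamma_kernel x w.
Proof. by rewrite mulr_ge0 ?expR_ge0 ?powR_ge0. Qed.

Lemma measurable_gamma_kernel x D : measurable_fun D (gamma_kernel x).
Proof.
apply: measurable_funTS; apply: measurable_funM; last exact: measurable_powR.
by apply: measurableT_comp => //; exact: oppr_measurable.
Qed.

Lemma powR_continuous_gt0 (p w : R) : 0 < w -> {for w, continuous (fun y => y `^ p)}.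
Proof.
move=> w0; apply/differentiable_continuous/derivable1_diffP.
by apply: derivable_powR; rewrite in_itv /= w0.
Qed.

Lemma gamma_kernel_continuous_gt0 x w : 0 < w -> {for w, continuous (gamma_kernel x)}.
Proof.
move=> w0; apply: cvgM; last exact: powR_continuous_gt0.
by apply: continuous_comp; [exact: oppr_continuous|exact: continuous_expR].
Qed.

(** Take 1 + y <= e^y at y = w / (2q), multiply by 2q, raise to the power q, and use 1 + w <= 2q +
    w. Passing through 1 + w >= 1 allows the exponent p to grow to q = p + 1, which is positive even
    for p = 0. The rate 1/2 leaves half of the decay of e^(-w). *)
Lemma powR_le_expR (p : R) : 0 <= p ->
  exists K, forall w, 0 <= w -> w `^ p <= K * expR (w / 2).
Proof.
move=> p0; pose q := p + 1; have q0 : 0 < q by rewrite ltr_wpDl.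
exists ((2 * q) `^ q) => w w0.
have -> : expR (w / 2) = expR (w / (2 * q)) `^ q.
  by rewrite -expRM; congr expR; field; rewrite lt0r_neq0.
rewrite -powRM ?expR_ge0 ?mulr_ge0 ?(ltW q0)//.
apply: (@le_trans _ _ ((1 + w) `^ p)).
  by apply: ge0_ler_powR; rewrite ?nnegrE//; lra.
apply: (@le_trans _ _ ((1 + w) `^ q)).
  by apply: ler_powR; rewrite /q; lra.
apply: ge0_ler_powR; rewrite ?nnegrE ?(ltW q0)//; first by lra.
  by rewrite mulr_ge0 ?expR_ge0//; lra.
have := expR_ge1Dx (w / (2 * q)) => h.
apply: (@le_trans _ _ (2 * q * (1 + w / (2 * q)))); last by rewrite ler_pM2l//; lra.
have e : 2 * q * (w / (2 * q)) = w by rewrite mulrC divfK// lt0r_neq0//; lra.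
by rewrite mulrDr mulr1 e lerD2r /q; lra.
Qed.

(** Integration by parts on compact intervals exhausting ]0, +oo[. The identity is between extended
    reals, so it does not presuppose integrability and can be used to prove it. *)
Lemma gamma_kernel_recl_integral x : 0 < x ->
  (\int[mu]_(w in `[0%R, +oo[) (gamma_kernel (x + 1) w)%:E =
   x%:E * \int[mu]_(w in `[0%R, +oo[) (gamma_kernel x w)%:E)%E.
Proof.
move=> x0.
(* The left ends avoid 0, where w^(x-1) is singular for x < 1; starting at 2 makes [a n < b n]
   strict already for n = 0. *)
pose a n : R := n.+2%:R^-1; pose b n : R := n.+2%:R.
have a0 n : 0 < a n by rewrite invr_gt0.
have b0 n : 0 < b n by [].
have ab n : a n < b n.
  rewrite (@lt_trans _ _ 1)// /a /b ?ltr1n// invf_lt1 ?ltr1n//.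
pose I n := `[a n, b n]%classic.
have cvI y : (\int[mu]_(w in I n) (gamma_kernel y w)%:E)%E @[n --> \oo] -->
    (\int[mu]_(w in `[0%R, +oo[) (gamma_kernel y w)%:E)%E.
  have -> : (\int[mu]_(w in `[0%R, +oo[) (gamma_kernel y w)%:E =
      \int[mu]_(w in \bigcup_n I n) (gamma_kernel y w)%:E)%E.
    rewrite -integral_itv_obnd_cbnd//; last first.
      by apply/measurable_EFinP; exact: measurable_gamma_kernel.
    congr (integral _ _ _); apply/seteqP; split => w /=; rewrite in_itv/= andbT; last first.
      by move=> [n _]; rewrite /I /= in_itv /= => /andP[+ _]; exact: lt_le_trans.
    (* For this index n, both w and 1/w are below n + 1, hence w lies between [a n] and [b n]. *)
    move=> w0; exists (Num.truncn (Num.max w w^-1)) => //=.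
    have := truncnS_gt (Num.max w w^-1).
    set N := Num.truncn _; rewrite gt_max => /andP[wN wVN].
    rewrite /I /= in_itv /= /a /b -[leRHS]invrK lef_pV2 ?posrE ?invr_gt0//.
    by rewrite !ltW//; apply: lt_trans (_ : _ < N.+1%:R) _; rewrite ?ltr_nat.
  apply: ge0_nondecreasing_set_cvg_integral => //.
  - apply/nondecreasing_seqP => n; rewrite subsetEset; apply: subset_itv; rewrite bnd_simp.
      by rewrite /a lef_pV2 ?posrE ?ltr0n// ler_nat.
    by rewrite /b ler_nat.
  - by move=> i; exact: measurable_itv.
  - by move=> i; apply/measurable_EFinP; exact: measurable_gamma_kernel.
  - by move=> i w _; rewrite lee_fin gamma_kernel_ge0.
have parts n : (\int[mu]_(w in I n) (gamma_kernel (x + 1) w)%:E =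
    (a n `^ x * expR (- a n) - b n `^ x * expR (- b n))%:E +
    x%:E * \int[mu]_(w in I n) (gamma_kernel x w)%:E)%E.
  have abpos w : a n <= w <= b n -> 0 < w by move=> /andP[+ _]; exact: lt_le_trans.
  have opos w : w \in `]a n, b n[ -> 0 < w.
    by rewrite in_itv /= => /andP[+ _]; exact: lt_trans.
  have der_exp w : is_derive w 1 (fun y : R => - expR (- y)) (expR (- w)).
    by apply: is_derive_eq; rewrite /GRing.scale /= !mulrN1 opprK.
  have cexp w : (fun y : R => - expR (- y)) @ w --> - expR (- w).
    apply: cvgN; apply: (continuous_comp (@oppr_continuous _ _ w)); exact: continuous_expR.
  have := @integration_by_parts R (fun w => w `^ x) (fun w => - expR (- w))
    (fun w => x * w `^ (x - 1)) (fun w => expR (- w)) (a n) (b n) (ab n).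
  move=> /(_ _ _ _ _ _ _)/wrap[].
  - apply: continuous_in_subspaceT => w; rewrite inE /= in_itv /= => /abpos w0.
    by apply: cvgM; [exact: cvg_cst|exact: powR_continuous_gt0].
  - split.
    + by move=> w /opos w0; apply: derivable_powR; rewrite in_itv /= w0.
    + by apply: cvg_at_right_filter; exact: powR_continuous_gt0.
    + by apply: cvg_at_left_filter; exact: powR_continuous_gt0.
  - move=> w /opos w0; rewrite derive1E.
    exact: (@derive_val _ _ _ _ _ _ _ (is_derive1_powR x w0)).
  - apply: continuous_subspaceT => w.
    by apply: (continuous_comp (@oppr_continuous _ _ w)); exact: continuous_expR.
  - split.
    + by move=> w _; apply: ex_derive.
    + by apply: cvg_at_right_filter.
    + by apply: cvg_at_left_filter.
  - by move=> w _; rewrite derive1E; exact: derive_val.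
  rewrite (_ : \int[mu]_(w in _) _ =
      \int[mu]_(w in I n) (gamma_kernel (x + 1) w)%:E)%E; last first.
    by apply: eq_integral => w _; rewrite /gamma_kernel addrK mulrC.
  move=> ->; congr (_ + _)%E; first by congr EFin; ring.
  rewrite -ge0_integralZl//; last 4 first.
  - exact: measurable_itv.
  - by apply/measurable_EFinP; exact: measurable_gamma_kernel.
  - by move=> w _; rewrite lee_fin gamma_kernel_ge0.
  - by rewrite lee_fin ltW.
  rewrite -[RHS]oppeK -integral_ge0N; last first.
    by move=> w _; rewrite mule_ge0 ?lee_fin ?(ltW x0) ?gamma_kernel_ge0.
  congr (- _)%E; apply: eq_integral => w _.
  by rewrite /gamma_kernel -EFinM -EFinN; congr EFin; ring.
have cva : a n `^ x * expR (- a n) - b n `^ x * expR (- b n) @[n --> \oo] --> (0 : R).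
  have cva0 : a @ \oo --> (0 : R).
    by have := @cvg_harmonic R; rewrite -cvg_shiftS.
  have cva1 : a @ \oo --> (0 : R)^'+.
    by move=> A /cva0 /= [N _ hA]; exists N => // i /hA /=; apply; exact: a0.
  rewrite [X in _ --> X](_ : 0 = 0 - 0); last by rewrite subr0.
  apply: cvgB.
    have cvax : a n `^ x @[n --> \oo] --> (0 : R).
      exact: (cvg_comp _ _ cva1 (powR_cvg0 x0)).
    apply: (squeeze_cvgr _ (cvg_cst 0) cvax); apply: nearW => n.
    rewrite mulr_ge0 ?powR_ge0 ?expR_ge0//= ler_piMr ?powR_ge0//.
    by rewrite -expR0 ler_expR oppr_le0 ltW.
  (* At the right end, b^x e^(-b) <= K e^(-b/2) <= 2K / b, the last step by 1 + b/2 <= e^(b/2). *)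
  have [K hK] := powR_le_expR (ltW x0).
  have cvKa : (K * 2) * a n @[n --> \oo] --> (0 : R).
    by rewrite [X in _ --> X](_ : 0 = (K * 2) * 0); [exact: cvgMr|rewrite mulr0].
  apply: (squeeze_cvgr _ (cvg_cst 0) cvKa); apply: nearW => n.
  rewrite mulr_ge0 ?powR_ge0 ?expR_ge0//=.
  have bK := hK _ (ltW (b0 n)).
  have K0 : 0 <= K.
    by have := le_trans (powR_ge0 _ _) bK; rewrite pmulr_lge0// expR_gt0.
  apply: (@le_trans _ _ (K * expR (b n / 2) * expR (- b n))).
    by rewrite ler_wpM2r ?expR_ge0.
  rewrite -!mulrA ler_wpM2l// -expRD (_ : b n / 2 - b n = - (b n / 2)); last by field.
  rewrite expRN (_ : 2 * a n = (b n / 2)^-1); last by rewrite /a invf_div.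
  rewrite lef_pV2 ?posrE ?expR_gt0 ?divr_gt0//.
  by have := expR_ge1Dx (b n / 2); lra.
suff cvx : (\int[mu]_(w in I n) (gamma_kernel (x + 1) w)%:E)%E @[n --> \oo] -->
    (x%:E * \int[mu]_(w in `[0%R, +oo[) (gamma_kernel x w)%:E)%E.
  exact: (cvg_unique _ (cvI (x + 1)) cvx).
have -> : (fun n => \int[mu]_(w in I n) (gamma_kernel (x + 1) w)%:E)%E =
    ((fun n => (a n `^ x * expR (- a n) - b n `^ x * expR (- b n))%:E) \+
     (fun n => x%:E * \int[mu]_(w in I n) (gamma_kernel x w)%:E))%E.
  by apply/funext => n; exact: parts.
have -> : (x%:E * \int[mu]_(w in `[0%R, +oo[) (gamma_kernel x w)%:E =
    0 + x%:E * \int[mu]_(w in `[0%R, +oo[) (gamma_kernel x w)%:E)%E.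
  by rewrite add0e.
apply: cvgeD; last by apply: cvgeZl.
  by rewrite fin_num_adde_defr.
by apply: cvg_EFin => //; exact: nearW.
Qed.

(** For exponents at least 1 the kernel is below a multiple of the exponential density of rate 1/2.
    Finiteness then passes from x + 1 down to any x > 0 by the recursion, whose factor x is
    positive. *)
Lemma gamma_kernel_integrable x : 0 < x ->
  mu.-integrable `[0%R, +oo[ (EFin \o gamma_kernel x).
Proof.
have ge1 y : 1 <= y -> mu.-integrable `[0%R, +oo[ (EFin \o gamma_kernel y).
  move=> y1; have [K hK] : exists K, forall w, 0 <= w -> w `^ (y - 1) <= K * expR (w / 2).
    by apply: powR_le_expR; lra.
  have ipdf : mu.-integrable `[0%R, +oo[ (EFin \o exponential_pdf (2^-1 : R)).
    by apply: integrableS (integrable_exponential_pdf _).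
  apply: le_integrable (integrableZl _ (2 * K) ipdf) => //.
    by apply/measurable_EFinP; exact: measurable_gamma_kernel.
  move=> w /= w0; rewrite lee_fin ger0_norm ?gamma_kernel_ge0//.
  rewrite /exponential_pdf patchE mem_set//; apply: le_trans (ler_norm _).
  move: w0; rewrite in_itv/= andbT => w0.
  apply: (@le_trans _ _ (expR (- w) * (K * expR (w / 2)))).
    by rewrite ler_wpM2l ?expR_ge0// hK.
  rewrite mulrCA -expRD (_ : - w + w / 2 = - 2^-1 * w); last by field.
  by rewrite le_eqVlt; apply/orP; left; apply/eqP; field.
move=> x0; apply/integrableP; split.
  by apply/measurable_EFinP; exact: measurable_gamma_kernel.
have /integrableP[_] := ge1 (x + 1) ltac:(lra).
have normE y : (\int[mu]_(w in `[0%R, +oo[) `|(EFin \o gamma_kernel y) w| =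
    \int[mu]_(w in `[0%R, +oo[) (gamma_kernel y w)%:E)%E.
  by apply: eq_integral => w _; rewrite /= ger0_norm ?gamma_kernel_ge0.
rewrite !normE gamma_kernel_recl_integral//.
have : (0 <= \int[mu]_(w in `[0%R, +oo[) (gamma_kernel x w)%:E)%E.
  by apply: integral_ge0 => w _; rewrite lee_fin gamma_kernel_ge0.
case: (integral mu _ _) => [r _ _|//_|//]; first by rewrite ltry.
by rewrite gt0_muley// lte_fin.
Qed.

Lemma Gamma_gt0E x : 0 < x -> Gamma x = upper_gamma x 0.
Proof. by rewrite /Gamma => ->. Qed.

Lemma GammaS x : 0 < x -> Gamma (x + 1) = x * Gamma x.
Proof.
move=> x0; rewrite !Gamma_gt0E ?addr_gt0// /upper_gamma /Rintegral.
rewrite gamma_kernel_recl_integral// fineM//.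
exact: integrable_fin_num (gamma_kernel_integrable x0).
Qed.

Lemma Gamma_gt0 x : 0 < x -> 0 < Gamma x.
Proof.
move=> x0; rewrite Gamma_gt0E// /upper_gamma /Rintegral -lte_fin fineK; last first.
  exact: integrable_fin_num (gamma_kernel_integrable x0).
(* On [1, 2], e^(-w) >= e^(-2) and w^(x-1) >= 1/w >= 1/2. *)
apply: (@lt_le_trans _ _ (\int[mu]_(w in `[1%R, 2%R]) (expR (-2) / 2)%:E)%E).
  rewrite integral_cst//= lebesgue_measure_itv/= lte_fin ltr1n.
  rewrite -EFinD -EFinM lte_fin mulr_gt0// ?divr_gt0 ?expR_gt0//; lra.
apply: (@le_trans _ _ (\int[mu]_(w in `[1%R, 2%R]) (gamma_kernel x w)%:E)%E).
  apply: ge0_le_integral => //=.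
  - by apply/measurable_EFinP; exact: measurable_gamma_kernel.
  move=> w; rewrite in_itv/= => /andP[w1 w2]; rewrite lee_fin.
  apply: ler_pM; rewrite ?expR_ge0//; first by rewrite ler_expR lerN2.
  apply: (@le_trans _ _ (w `^ (-1))); last by apply: ler_powR => //; lra.
  by rewrite powR_inv1 ?lef_pV2 ?posrE//; lra.
apply: ge0_subset_integral => //=.
- by apply/measurable_EFinP; exact: measurable_gamma_kernel.
- by move=> w _; rewrite lee_fin gamma_kernel_ge0.
- by apply: subset_itv; rewrite bnd_simp.
Qed.

(* Also valid at the poles of Gamma, where both sides vanish. *)
Lemma invr_Gamma_rec x : (Gamma x)^-1 = x * (Gamma (x + 1))^-1.
Proof.
have [x0|x0] := ltP 0 x.
  by rewrite GammaS// invfM mulrA mulfV ?mul1r// gt_eqF.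
rewrite {1}/Gamma ltNge x0 /=.
have [x1|x1] := ltP 0 (x + 1).
  rewrite Gamma_gt0E// (_ : Num.truncn _ = 0)%N; last first.
    by apply: truncn_def; apply/andP; split; lra.
  by rewrite big_ord1 addr0 invf_div mulrC.
rewrite /Gamma ltNge x1 /=.
(* Passing from x to x + 1 drops one factor of the product, so both sides end with [upper_gamma] at
   the same point. *)
have -> : Num.truncn (- x) = (Num.truncn (- (x + 1))).+1.
  have /truncn_itv/andP[h1 h2] : 0 <= - (x + 1) by lra.
  by apply: truncn_def; move: h1 h2; rewrite -!natr1 => h1 h2; apply/andP; split; lra.
rewrite big_ord_recl /= addr0 !invf_div !mulrA -natr1; congr (_ * _ / upper_gamma _ _).
  by apply: eq_bigr => i _; rewrite /bump /= natrD; ring.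
by ring.
Qed.

(** Near w the function is its value at 0 minus the integral over [0, y], to which the fundamental
    theorem of calculus applies on [0, w + 1]. *)
Lemma is_derive_upper_gamma (rho w : R) : 0 < rho -> 0 < w ->
  is_derive w 1 (upper_gamma rho) (- (expR (- w) * w `^ (rho - 1))).
Proof.
move=> rho0 w0.
have ik := gamma_kernel_integrable rho0.
have ikS : mu.-integrable `[0%R, (w + 1)%R] (EFin \o gamma_kernel rho).
  by apply: integrableS ik => //; apply: subset_itvl; rewrite bnd_simp.
have ww : w < w + 1 by rewrite ltrDl.
have [dF F'] := @continuous_FTC1_closed R (gamma_kernel rho) 0 w (w + 1)
  ww ikS w0 (@gamma_kernel_continuous_gt0 rho w w0).
have dFw : is_derive w 1 (fun y => \int[mu]_(t in `[0, y]) gamma_kernel rho t)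
    (gamma_kernel rho w).
  by split; [exact: dF|rewrite -derive1E F'].
have dG : is_derive w 1
    (fun y => upper_gamma rho 0 - \int[mu]_(t in `[0, y]) gamma_kernel rho t)
    (- gamma_kernel rho w).
  by have := is_deriveB (is_derive_cst (upper_gamma rho 0) w 1) dFw; rewrite sub0r.
apply: near_eq_is_derive dG.
near=> y; have y0 : 0 < y by near: y; exact: lt_nbhsr.
rewrite /upper_gamma (Rintegral_itvB ik) ?bnd_simp ?ltW//.
rewrite -Rintegral_itv_obnd_cbnd//.
by apply: integrableS ik => //; apply: subset_itvr; rewrite bnd_simp ltW.
Unshelve. all: by end_near. Qed.

End gamma_integral.

(** * Derivatives of the incomplete Gamma function *)

Section entire_series.
Variable R : realType.
Implicit Types (c : R^nat) (x w : R).

(** Convergence at K >= 1 with |x| <= K/4 bounds |c (n+1)| K^n, so the n-th term is at most a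
    constant times (n+1) 4^(-n). One factor 2^(-n) absorbs n + 1 <= 2^n and the other leaves a
    geometric series. *)
Lemma is_cvg_pseries_diffs c : (forall x, cvgn (pseries c x)) ->
  forall x, cvgn (pseries (pseries_diffs c) x).
Proof.
move=> cc x.
have [K [K1 xK4]] : exists K : R, 1 <= K /\ `|x| <= K * 4^-1.
  by exists (4 * (`|x| + 1)); have := normr_ge0 x; split; lra.
have K0 : 0 < K by exact: lt_le_trans K1.
have [M [_ hM]] := cvg_series_bounded (cc K).
pose M1 := `|M| + 1.
have cM i : `|c i| * K ^+ i <= M1.
  have := hM M1 ltac:(by rewrite /M1 (le_lt_trans (ler_norm M))// ltrDl) i Logic.I.
  by rewrite /= normrM normrX (gtr0_norm K0).
apply: normed_cvg.
have M10 : 0 <= M1 by rewrite addr_ge0.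
have g0 n : 0 <= geometric M1 (2^-1 : R) n by rewrite /= mulr_ge0// exprn_ge0.
apply: series_le_cvg g0 _ _ => [n /=|n /=|].
- exact: normr_ge0.
- rewrite /pseries_diffs !normrM normrX ger0_norm//.
  have cn : `|c n.+1| * K ^+ n <= M1.
    apply: le_trans (cM n.+1); rewrite ler_wpM2l// exprS ler_peMl//.
    by rewrite exprn_ge0// ltW.
  have xK : `|x| ^+ n <= (K * 4^-1) ^+ n.
    by rewrite lerXn2r ?nnegrE ?divr_ge0 ?(ltW K0).
  have n2 : n.+1%:R <= 2 ^+ n :> R by rewrite -natrX ler_nat ltn_expl.
  apply: (@le_trans _ _ (2 ^+ n * `|c n.+1| * (K * 4^-1) ^+ n)).
    by rewrite ler_pM ?mulr_ge0 ?exprn_ge0// ler_wpM2r.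
  rewrite exprMn (_ : 4^-1 = 2^-1 * 2^-1); last by field.
  rewrite exprMn [X in X <= _](_ : _ =
      (2 * 2^-1) ^+ n * 2^-1 ^+ n * (`|c n.+1| * K ^+ n)); last first.
    by rewrite exprMn; ring.
  by rewrite mulfV// expr1n mul1r mulrC ler_wpM2r ?exprn_ge0.
by apply: is_cvg_geometric_series; rewrite ger0_norm// invf_lt1// ltr1n.
Qed.

(** Multiplying the j-th coefficient by j is the Euler operator x d/dx. *)
Lemma limn_pseries_muln c x : (forall x, cvgn (pseries c x)) ->
  pseries (fun j => j%:R * c j) x @ \oo --> x * limn (pseries (pseries_diffs c) x).
Proof.
move=> cc; have := pseries_diffs_equiv (@is_cvg_pseries_diffs c cc x).
set s := (X in series X) => scvg.
rewrite (_ : pseries _ _ = (fun n => x * series s n)); first exact: cvgMr.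
apply/funext => n; rewrite /pseries /series /= mulr_sumr; apply: eq_bigr => -[|i] _ /=.
  by rewrite /s !mul0r mulr0.
by rewrite /s exprS; ring.
Qed.

(* Coefficients of the m-th termwise derivative of e^(-x) x^a, as multiples of
   x^(a - m + j). *)
Definition gamma_coef (a : R) (m j : nat) : R :=
  (-1) ^+ j / j`!%:R * \prod_(i < m) (a + j%:R - i%:R).

(** The two summands mirror the product rule for w^(a-m) times a series: a - m comes from the power,
    j from the Euler operator on the series. *)
Lemma gamma_coefS a m j :
  gamma_coef a m.+1 j = (a - m%:R) * gamma_coef a m j + j%:R * gamma_coef a m j.
Proof. by rewrite /gamma_coef big_ord_recr /=; ring. Qed.

Lemma pseries_gamma_coef0 a x : pseries (gamma_coef a 0) x = series (exp_coeff (- x)).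
Proof.
congr series; apply/funext => i.
by rewrite /gamma_coef /exp_coeff /= big_ord0 mulr1 [in RHS]exprNn; ring.
Qed.

Lemma pseries_gamma_coefS a m x : pseries (gamma_coef a m.+1) x =
  (fun n => (a - m%:R) * pseries (gamma_coef a m) x n +
    pseries (fun j => j%:R * gamma_coef a m j) x n).
Proof.
apply/funext => n; rewrite /pseries /series /= mulr_sumr -big_split /=.
by apply: eq_bigr => i _; rewrite gamma_coefS; ring.
Qed.

Lemma is_cvg_pseries_gamma_coef a m x : cvgn (pseries (gamma_coef a m) x).
Proof.
elim: m x => [|m IH] x.
  by rewrite pseries_gamma_coef0; exact: is_cvg_series_exp_coeff.
rewrite pseries_gamma_coefS; apply: is_cvgD; first by apply: is_cvgMr; exact: IH.
apply/cvg_ex; exists (x * limn (pseries (pseries_diffs (gamma_coef a m)) x)).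
exact: limn_pseries_muln.
Qed.

(** The m-th derivative of e^(-w) w^a for w > 0. The real power is kept apart so that the other
    factor is an entire power series. *)
Definition gamma_derive a m w : R := w `^ (a - m%:R) * limn (pseries (gamma_coef a m) w).

Lemma gamma_derive0 a w : gamma_derive a 0 w = expR (- w) * w `^ a.
Proof. by rewrite /gamma_derive pseries_gamma_coef0 subr0 mulrC. Qed.

Lemma limn_pseries_gamma_coefS a m w : limn (pseries (gamma_coef a m.+1) w) =
  (a - m%:R) * limn (pseries (gamma_coef a m) w) +
  w * limn (pseries (pseries_diffs (gamma_coef a m)) w).
Proof.
rewrite pseries_gamma_coefS; apply/cvg_lim => //; apply: cvgD.
  by apply: cvgMr; exact: is_cvg_pseries_gamma_coef.
by apply: limn_pseries_muln; exact: is_cvg_pseries_gamma_coef.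
Qed.

Lemma is_derive_gamma_derive a m w : 0 < w ->
  is_derive w 1 (gamma_derive a m) (gamma_derive a m.+1 w).
Proof.
move=> w0; have cc := @is_cvg_pseries_gamma_coef a m.
have cd := @is_cvg_pseries_diffs _ cc; have cdd := @is_cvg_pseries_diffs _ cd.
(* Termwise differentiation at w uses convergence of the series and of its first two derived series
   at a point of larger modulus, here w + 1. *)
have dP := @pseries_snd_diffs R (gamma_coef a m) (w + 1) w (cc _) (cd _) (cdd _).
have {}dP : is_derive w 1 (fun x => limn (pseries (gamma_coef a m) x))
    (limn (pseries (pseries_diffs (gamma_coef a m)) w)).
  by apply: dP; rewrite !gtr0_norm ?addr_gt0// ltrDl.
have dw := is_derive1_powR (a - m%:R) w0.
have := is_deriveM dw dP; rewrite /gamma_derive limn_pseries_gamma_coefS.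
rewrite /GRing.scale /= => h; apply: is_derive_eq h _.
have e : w `^ (a - m%:R) = w `^ (a - m%:R - 1) * w.
  by rewrite -[in LHS](subrK 1 (a - m%:R)) powRD ?powRr1 ?(ltW w0)// (gt_eqF w0) implybT.
have -> : a - m.+1%:R = a - m%:R - 1 by rewrite -natr1; ring.
by rewrite e; ring.
Qed.

(** Working with 1/Gamma keeps the formula true at the poles, which the Prabhakar coefficients can
    meet when rho is an integer. *)
Lemma invr_Gamma_subn x m :
  (Gamma (x - m%:R))^-1 = \prod_(i < m) (x - 1 - i%:R) * (Gamma x)^-1.
Proof.
elim: m => [|m IH]; first by rewrite subr0 big_ord0 mul1r.
rewrite invr_Gamma_rec -natr1 opprD addrA subrK IH big_ord_recr /=.
by rewrite [x - 1 - _]addrAC; ring.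
Qed.

(** Coefficientwise, the Gamma(rho + j) of the Pochhammer symbol cancels the one produced by
    lowering the argument of 1/Gamma(rho + j - m). What remains is [gamma_coef (rho - 1) m j]
    divided by Gamma(rho). *)
Lemma gamma_derive_prabhakar (rho theta : R) m : 0 < rho ->
  gamma_derive (rho - 1) m theta =
  Gamma rho * theta `^ (rho - m.+1%:R) * prabhakar 1 (rho + 1 - m.+1%:R) rho (- theta).
Proof.
move=> rho0; have G0 := Gamma_gt0 rho0.
rewrite /gamma_derive /prabhakar.
have -> : rho - 1 - m%:R = rho - m.+1%:R by rewrite -natr1; ring.
rewrite (_ : series _ =
    (fun n => (Gamma rho)^-1 * pseries (gamma_coef (rho - 1) m) theta n)).
  rewrite [X in _ = _ * X](_ : _ =
      (Gamma rho)^-1 * limn (pseries (gamma_coef (rho - 1) m) theta)).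
    by field; rewrite gt_eqF.
  by apply/cvg_lim => //; apply: cvgMr; exact: is_cvg_pseries_gamma_coef.
apply/funext => n; rewrite /series /pseries /= mulr_sumr.
apply: eq_bigr => j _; rewrite /pochhammer mul1r.
have -> : j%:R + (rho + 1 - m.+1%:R) = rho + j%:R - m%:R by rewrite -natr1; ring.
rewrite invfM invr_Gamma_subn /gamma_coef [(- theta) ^+ j]exprNn.
have Gj : Gamma (rho + j%:R) != 0 by rewrite gt_eqF// Gamma_gt0// ltr_wpDr.
rewrite (eq_bigr (fun i : 'I_m => rho - 1 + j%:R - i%:R)); last by move=> i _; ring.
have fj : j`!%:R != 0 :> R by rewrite pnatr_eq0 -lt0n fact_gt0.
by field; rewrite fj Gj (lt0r_neq0 G0).
Qed.

End entire_series.

(** * Pairings with Schwartz functions *)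

Lemma Lnorm2_sqr d (T : measurableType d) (R : realType)
    (mu : {measure set T -> \bar R}) (f : T -> R) :
  ('N[mu]_2%:E[EFin \o f] ^+ 2 = \int[mu]_x (f x ^+ 2)%:E)%E.
Proof.
have <- : ('N[mu]_2%:E[EFin \o f] `^ 2 = 'N[mu]_2%:E[EFin \o f] ^+ 2)%E.
  move: (Lnorm_ge0 mu 2%:E (EFin \o f)); case: Lnorm => [r r0|_|//].
    by rewrite poweR_EFin powR_mulrn.
  by rewrite poweRyr.
rewrite poweR_Lnorm//; apply: eq_integral => x _ /=.
by rewrite powR_mulrn// real_normK ?num_real.
Qed.

Section schwartz_dual.
Variable R : realType.
Implicit Types (f g xi : schwartz R) (t : R).
Local Notation mu := (@lebesgue_measure R).

Lemma integrable_oneDsqrV : mu.-integrable setT (EFin \o (fun x : R => (1 + x ^+ 2)^-1)).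
Proof.
have ge0 (x : R) : 0 <= (1 + x ^+ 2)^-1 by rewrite invr_ge0 addr_ge0// sqr_ge0.
have cf : continuous (fun x : R => (1 + x ^+ 2)^-1) := @continuous_oneDsqrV R.
apply/integrableP; split.
  by apply/measurable_EFinP; exact: continuous_measurable_fun.
under eq_integral do rewrite /= ger0_norm//.
rewrite ge0_symfun_integralT//; last by move=> x; rewrite /= sqrrN.
rewrite -set_itvcy; have := @integral0y_oneDsqr R; rewrite /oneDsqr => ->.
by rewrite -EFinM ltry.
Qed.

Lemma schwartzP f : is_schwartz f.
Proof. by case: f => f /=; rewrite unfold_in => /asboolP. Qed.

Lemma schwartz_continuous f : continuous (f : R -> R).
Proof.
have [df _] := schwartzP f; move=> x.
by apply/differentiable_continuous/derivable1_diffP; exact: (df 0%N).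
Qed.

(** Bounds on |f|, |g| and x^2 |g| give |f g| <= M (N0 + N2) / (1 + x^2). *)
Lemma schwartz_mul_integrable f g :
  mu.-integrable setT (EFin \o (fun x => (f x : R) * g x)).
Proof.
have [_ bf] := schwartzP f; have [_ bg] := schwartzP g.
have [M hM] := bf 0%N 0%N; have [N0 hN0] := bg 0%N 0%N; have [N2 hN2] := bg 2%N 0%N.
apply: le_integrable (integrableZl measurableT (M * (N0 + N2)) integrable_oneDsqrV) => //.
  by apply/measurable_EFinP; apply: measurable_funM;
    apply: continuous_measurable_fun; exact: schwartz_continuous.
move=> x _; rewrite /= lee_fin; apply: le_trans (ler_norm _).
have x0 : 0 < 1 + x ^+ 2 by rewrite ltr_pwDl// sqr_ge0.
rewrite ler_pdivlMr// normrM -mulrA; apply: ler_pM => //.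
  by rewrite mulr_ge0// ltW.
  by have := hM x; rewrite expr0 mul1r.
rewrite mulrDr mulr1; apply: lerD; first by have := hN0 x; rewrite expr0 mul1r.
by have := hN2 x; rewrite normrM [`|x ^+ 2|]ger0_norm ?sqr_ge0// mulrC.
Qed.

Lemma schwartz_scaleE t f (x : R) : (t *: f) x = t * f x.
Proof. by []. Qed.

Lemma schwartz_addE f g (x : R) : (f + g) x = f x + g x.
Proof. by []. Qed.

Lemma L2dotZ t f : L2dot (t *: f) (t *: f) = t ^+ 2 * L2dot f f.
Proof.
rewrite /L2dot -RintegralZl//; last exact: schwartz_mul_integrable.
by apply: eq_Rintegral => x _; rewrite schwartz_scaleE expr2; ring.
Qed.

Lemma L2dotD f g : L2dot (f + g) (f + g) = L2dot f f + 2 * L2dot f g + L2dot g g.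
Proof.
have ifg := @schwartz_mul_integrable.
have ifg2 : mu.-integrable setT (EFin \o (fun x => 2 * ((f x : R) * g x))).
  exact: (integrableZl measurableT 2 (ifg f g)).
rewrite /L2dot -RintegralZl// -RintegralD// -RintegralD//.
  by apply: eq_Rintegral => x _; rewrite schwartz_addE; ring.
exact: (integrableD measurableT (ifg f f) ifg2).
Qed.

Lemma L2dot_ge0 f : 0 <= L2dot f f.
Proof. by apply: Rintegral_ge0 => x _; rewrite -expr2 sqr_ge0. Qed.

Lemma L2norm_sqr f : L2norm f ^+ 2 = L2dot f f.
Proof.
rewrite /L2norm /L2dot /Rintegral.
transitivity (fine ('N[mu]_2%:E[EFin \o f] ^+ 2)%E).
  (* [fine] sends the infinite values to 0, so it commutes with squaring there as well. *)
  case: Lnorm => [r||]; first by rewrite -EFin_expe.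
    by rewrite expe2 mulyy expr0n.
  by rewrite expe2 mulNyNy expr0n.
by rewrite Lnorm2_sqr; congr fine; apply: eq_integral => x _; rewrite expr2.
Qed.

Lemma measurable_pairing xi : measurable_fun setT (fun x : tempered R => (x xi : R)).
Proof.
move=> _ B mB; rewrite setTI.
(* The preimage of [B] is a cylinder over the single test function [xi]. *)
apply: sub_sigma_algebra; exists 1%N, [tuple xi], [set t | B (tnth t ord0)]; split.
  rewrite -[X in measurable X]setTI.
  exact: (measurable_tnth ord0).
apply/seteqP; split => x /=; by rewrite tnth_mktuple.
Qed.

End schwartz_dual.

(** * Moments of the Gamma-grey measure *)

Section gamma_grey_moments.
Variables (R : realType) (rho theta : R).
Hypotheses (rho_gt0 : 0 < rho) (theta_gt0 : 0 < theta).
Variable nu : probability (tempered R) R.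
Hypothesis nu_grey : is_gamma_grey rho theta nu.

(** The characteristic functional at t xi is the characteristic function of the pairing with [xi] at
    t; the two claims are its real and imaginary parts. *)
Lemma gamma_grey_trig (xi : schwartz R) (t : R) :
  \int[nu]_x cos (t * x xi) =
    upper_gamma rho (theta + 2^-1 * L2dot xi xi * t ^+ 2) / upper_gamma rho theta /\
  \int[nu]_x sin (t * x xi) = 0.
Proof.
have := nu_grey (t *: xi); rewrite L2dotZ /cintegral => -[hc hs].
rewrite -mulrA [_ * t ^+ 2]mulrC -hc -[RHS in _ /\ _ = RHS]hs.
have xE (x : tempered R) : x (t *: xi) = t * x xi by rewrite linearZ.
split; apply: eq_Rintegral => x _; rewrite /cexp /= xE.
  by rewrite !(mul0r, mulr0, mul1r, oppr0, addr0, add0r) expR0 mul1r.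
  by rewrite !(mul0r, mulr0, mul1r, oppr0, addr0, add0r) expR0 mul1r.
Qed.

(** The successive derivatives of [upper_gamma rho] for w > 0; the sign and the index shift come
    from the first derivative being minus the integrand. *)
Let K (m : nat) : R -> R :=
  if m is m'.+1 then fun w => - gamma_derive (rho - 1) m' w else upper_gamma rho.

Lemma gamma_grey_even_moment (xi : schwartz R) (n : nat) :
  nu.-integrable setT (EFin \o (fun x : tempered R => x xi ^+ n.*2)) /\
  \int[nu]_x (x xi ^+ n.*2) = (-1) ^+ n * n.*2`!%:R *
    (K n theta / n`!%:R * (2^-1 * L2dot xi xi) ^+ n / upper_gamma rho theta).
Proof.
have dK m (w : R) : 0 < w -> is_derive w 1 (K m) (K m.+1 w).
  case: m => [|m] w0 /=.
    by rewrite gamma_derive0; exact: is_derive_upper_gamma.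
  by apply: is_deriveN; exact: is_derive_gamma_derive.
have [C hC] := taylor_bound theta_gt0 dK n.+1.
set G := upper_gamma rho theta; set s := 2^-1 * L2dot xi xi.
have s0 : 0 <= s by rewrite mulr_ge0// L2dot_ge0.
pose a m := K m theta / m`!%:R * s ^+ m / G.
(* The Taylor expansion at theta is taken in u = s t^2, so order n + 1 in u is order 2n + 2 in t.
   The radius 1/(1 + s) ensures both |t| <= 1 and s t^2 <= 1. *)
apply: (@even_moment _ _ _ nu _ (measurable_pairing xi) a n
  (C * s ^+ n.+1 * `|G^-1|) (1 + s)^-1).
  by rewrite invr_gt0; lra.
move=> t td; rewrite (gamma_grey_trig xi t).1 -/G -/s.
have t1 : `|t| <= 1 by apply: (le_trans td); rewrite invf_le1; lra.
have u01 : 0 <= s * t ^+ 2 <= 1.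
  rewrite mulr_ge0 ?sqr_ge0//= -real_normK ?num_real// expr2.
  have : `|t| * (1 + s) <= 1 by rewrite -ler_pdivlMr ?div1r//; lra.
  have := normr_ge0 t; nra.
rewrite (_ : \sum_(m < n.+1) _ =
    (\sum_(m < n.+1) K m theta / m`!%:R * (s * t ^+ 2) ^+ m) / G); last first.
  rewrite mulr_suml; apply: eq_bigr => m _.
  by rewrite /a [(s * _) ^+ _]exprMn -exprM mul2n; ring.
rewrite -mulrBl normrM.
have := hC _ u01; rewrite [(s * _) ^+ n.+1]exprMn -exprM mul2n doubleS => h.
have := ler_wpM2r (normr_ge0 G^-1) h; congr (_ <= _); ring.
Qed.

(** For n = 1 the Taylor coefficient is minus the integrand of [upper_gamma] at theta, hence
    elementary, and its sign cancels that of (-1)^1. *)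
Lemma gamma_grey_second_moment (xi : schwartz R) :
  \int[nu]_x (x xi ^+ 2) =
    theta `^ (rho - 1) * expR (- theta) / upper_gamma rho theta * L2dot xi xi.
Proof.
have [_] := gamma_grey_even_moment xi 1; rewrite /= => ->.
rewrite gamma_derive0 expr1 (_ : (1.*2)`! = 2)%N// divr1.
transitivity (2 / 2 * (theta `^ (rho - 1) * expR (- theta) / upper_gamma rho theta
  * L2dot xi xi)); first by ring.
by rewrite divff ?mul1r.
Qed.

End gamma_grey_moments.

Theorem corollary2p1 (R : realType) (rho theta : R)
    (hrho0 : 0 < rho) (hrho1 : rho <= 1) (htheta : 0 < theta)
    (nu : probability (tempered R) R) (hnu : is_gamma_grey rho theta nu) :
  (forall (xi : schwartz R) (n : nat),
     nu.-integrable setT (fun x => ((x xi) ^+ (2 * n + 1))%:E) /\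
     (\int[nu]_x ((x xi) ^+ (2 * n + 1))%:E)%E = 0%:E) /\
  (forall (xi : schwartz R) (n : nat), (1 <= n)%N ->
     nu.-integrable setT (fun x => ((x xi) ^+ (2 * n))%:E) /\
     (\int[nu]_x ((x xi) ^+ (2 * n))%:E)%E =
       ((-1) ^+ (n + 1) * ((2 * n)`!)%:R * Gamma rho * theta `^ (rho - n%:R)
          * L2dot xi xi ^+ n
        / (n`!%:R * 2 ^+ n * upper_gamma rho theta)
        * prabhakar 1 (rho + 1 - n%:R) rho (- theta))%:E) /\
  (forall xi1 xi2 : schwartz R,
     nu.-integrable setT (fun w => (w xi1 * w xi2)%:E) /\
     (\int[nu]_w (w xi1 * w xi2)%:E)%E =
       (theta `^ (rho - 1) * expR (- theta) / upper_gamma rho theta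
        * L2dot xi1 xi2)%:E) /\
  (forall xi : schwartz R,
     ('N[nu]_2%:E[(fun x => (x xi)%:E)] ^+ 2)%E =
       (theta `^ (rho - 1) * expR (- theta) * L2norm xi ^+ 2
        / upper_gamma rho theta)%:E).
Proof.
have integralE (f : tempered R -> R) : nu.-integrable setT (EFin \o f) ->
    (\int[nu]_x (f x)%:E)%E = (\int[nu]_x f x)%:E.
  by move=> fi; rewrite /Rintegral fineK//; exact: integrable_fin_num.
have even xi n := gamma_grey_even_moment hrho0 htheta hnu xi n.
have i2 xi : nu.-integrable setT (EFin \o (fun x : tempered R => x xi ^+ 2)) :=
  (even xi 1%N).1.
have second := gamma_grey_second_moment hrho0 htheta hnu.
split; [|split; [|split]].
- move=> xi n; rewrite addn1 mul2n.
  have [i e] := odd_moment (measurable_pairing xi)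
    (fun t => (gamma_grey_trig hnu xi t).2) (even xi n).1 (even xi n.+1).1.
  by split => //; rewrite integralE// e.
(* At a positive index the Taylor coefficient is minus a [gamma_derive]; this sign is the extra
   factor -1 in the statement. *)
- move=> xi [//|n] _; rewrite mul2n; have [i e] := even xi n.+1.
  split => //; rewrite integralE// e; congr EFin.
  rewrite gamma_derive_prabhakar// addn1 exprMn exprVn !exprS !invfM; ring.
- move=> xi1 xi2.
  (* Polarization reduces the covariance, and its integrability, to second moments. *)
  pose f (w : tempered R) := 2^-1 * (w (xi1 + xi2) ^+ 2 - w xi1 ^+ 2 - w xi2 ^+ 2).
  have fE (w : tempered R) : w xi1 * w xi2 = f w by rewrite /f linearD; field.
  have i12 : nu.-integrable setT (EFin \o
      (fun w : tempered R => w (xi1 + xi2) ^+ 2 - w xi1 ^+ 2)).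
    exact: (integrableB measurableT (i2 (xi1 + xi2)) (i2 xi1)).
  have i123 : nu.-integrable setT (EFin \o
      (fun w : tempered R => w (xi1 + xi2) ^+ 2 - w xi1 ^+ 2 - w xi2 ^+ 2)).
    exact: (integrableB measurableT i12 (i2 xi2)).
  have fi : nu.-integrable setT (EFin \o f) := integrableZl measurableT 2^-1 i123.
  rewrite (_ : (fun w : tempered R => (w xi1 * w xi2)%:E) = EFin \o f); last first.
    by apply/funext => w; rewrite /= fE.
  split => //; rewrite integralE// /f (RintegralZl _ measurableT i123).
  rewrite (RintegralB measurableT i12 (i2 xi2)) (RintegralB measurableT (i2 _) (i2 xi1)).
  rewrite !second L2dotD; congr EFin.
  transitivity (2 / 2 * (theta `^ (rho - 1) * expR (- theta) / upper_gamma rho theta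
    * L2dot xi1 xi2)); first by ring.
  by rewrite divff ?mul1r.
- move=> xi; rewrite (Lnorm2_sqr nu (fun x => x xi)) integralE// second.
  by rewrite L2norm_sqr; congr EFin; ring.
Qed.
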